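(* Let $C(\boldsymbol{u})=\psi(\ell_\alpha(\psi^{-1}[u_1],\dots,\psi^{-1}[u_d]))$, $\boldsymbol{u}\in[0,1]^d$, be a $d$-dimensional Archimax copula with generator $\psi\in\Psi_d$ and logistic stable tail dependence function $\ell_\alpha(\boldsymbol{x})=\bigl(\sum_{j=1}^d x_j^{1/\alpha}\bigr)^{\alpha}$, $\alpha\in(0,1]$, and let $\boldsymbol{t}\in(0,1]^d$ be such that $C(\boldsymbol{t})>0$. Then the copula of $C$ right-truncated at $\boldsymbol{t}$ is a tilted outer power Archimedean copula (and thus Archimedean): with $\mathring\psi(t)=\psi(t^\alpha)$ and $h=\mathring\psi^{-1}[C(\boldsymbol{t})]$, it is the Archimedean copula with generator $\tilde\psi(t)=\mathring\psi(t+h)/\mathring\psi(h)$, $t\in[0,\infty)$.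
   Context: For $\boldsymbol{U}\sim C$ ($C$ a $d$-dimensional copula) and $\boldsymbol{t}\in(0,1]^d$ with $C(\boldsymbol{t})>0$, the copula of $C$ right-truncated at $\boldsymbol{t}$ is the (unique) copula of the conditional distribution of $\boldsymbol{U}$ given $\boldsymbol{U}\le\boldsymbol{t}$ (componentwise). An Archimedean generator is a continuous, non-increasing function $\psi:[0,\infty)\to[0,1]$ with $\psi(0)=1$, $\lim_{t\to\infty}\psi(t)=0$, strictly decreasing on $[0,\inf\{t:\psi(t)=0\})$; $\psi^{-1}$ denotes its inverse on $(0,1]$, with $\psi^{-1}[0]=\inf\{t:\psi(t)=0\}$ (equal to $\infty$ if $\psi>0$ everywhere) and $\psi(\infty)=0$. A copula $C$ is Archimedean with generator $\psi$ if $C(\boldsymbol{u})=\psi(\psi^{-1}[u_1]+\dots+\psi^{-1}[u_d])$; $\Psi_d$ is the set of all generators which generate a $d$-dimensional Archimedean copula. Archimax copulas are copulas of the form $C(\boldsymbol{u})=\psi(\ell(\psi^{-1}[u_1],\dots,\psi^{-1}[u_d]))$ with $\psi\in\Psi_d$ and $\ell:[0,\infty)^d\to[0,\infty)$ a stable tail dependence function. Archimedean copulas generated by $\mathring\psi(t)=\psi(t^\alpha)$, $\alpha\in(0,1]$, are called outer power Archimedean copulas, and a tilted generator of a generator $\psi$ is $t\mapsto\psi(t+h)/\psi(h)$ for a tilt $h\ge0$. *)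

(* Defs.v *)
From HB Require Import structures.
From mathcomp Require Import all_boot all_order all_algebra.
From mathcomp Require Import all_classical all_reals all_analysis.

Set Implicit Arguments.
Unset Strict Implicit.
Unset Printing Implicit Defensive.

Import Order.TTheory GRing.Theory Num.Theory.
Import numFieldNormedType.Exports.

Local Open Scope classical_set_scope.
Local Open Scope ring_scope.

Definition unit_cube (R : realType) (d : nat) : set ('I_d -> R) :=
  [set u | forall j, 0 <= u j <= 1].

(* A copula is represented by a function on the whole of R^d of which only the
   values on [0,1]^d matter. Together with the uniform margins required by
   [copula], the values of the distribution function of [U] on [0,1]^d
   determine the law of [U]. *)
Definition has_copula_df (R : realType) (d : nat) (disp : measure_display)
    (T : measurableType disp) (P : probability T R)
    (U : 'I_d -> {RV P >-> R}) (C : ('I_d -> R) -> R) : Prop :=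
  forall u, unit_cube u -> P [set w | forall j, U j w <= u j] = (C u)%:E.

(* A copula is (the restriction to [0,1]^d of) the distribution function of a
   random vector with standard uniform univariate margins. *)
Definition copula (R : realType) (d : nat) (C : ('I_d -> R) -> R) : Prop :=
  exists (disp : measure_display) (T : measurableType disp)
         (P : probability T R) (U : 'I_d -> {RV P >-> R}),
    (forall j (u : R), 0 <= u <= 1 -> cdf (U j) u = u%:E) /\
    has_copula_df U C.

(* P (A | B), for P B > 0 *)
Definition cond_prob (R : realType) (disp : measure_display)
    (T : measurableType disp) (P : probability T R) (B A : set T) : R :=
  fine (P (A `&` B)) / fine (P B).

(* Sklar's representation, at every x in R^d, of the conditional distribution
   function of [U] given [B] through its own (conditional) margins. *)
Definition cond_copula (R : realType) (d : nat) (disp : measure_display)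
    (T : measurableType disp) (P : probability T R)
    (U : 'I_d -> {RV P >-> R}) (B : set T) (D : ('I_d -> R) -> R) : Prop :=
  copula D /\
  forall x : 'I_d -> R,
    cond_prob P B [set w | forall j, U j w <= x j] =
    D (fun j => cond_prob P B [set w | U j w <= x j]).

Definition right_truncated_copula (R : realType) (d : nat)
    (disp : measure_display) (T : measurableType disp) (P : probability T R)
    (U : 'I_d -> {RV P >-> R}) (t : 'I_d -> R) (D : ('I_d -> R) -> R) : Prop :=
  cond_copula U [set w | forall j, U j w <= t j] D.

(* inf {t >= 0 : psi t = 0}, equal to +oo when psi has no zero *)
Definition gen_zero (R : realType) (psi : R -> R) : \bar R :=
  ereal_inf [set s%:E | s in [set s : R | 0 <= s /\ psi s = 0]].

(* Only the values of psi on [0, +oo[ matter. *)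
Definition generator (R : realType) (psi : R -> R) : Prop :=
  [/\ {within [set s : R | 0 <= s], continuous psi},
      (forall s, 0 <= s -> 0 <= psi s <= 1),
      (forall s1 s2, 0 <= s1 -> s1 <= s2 -> psi s2 <= psi s1),
      psi 0 = 1 /\ psi s @[s --> +oo] --> (0 : R) &
      forall s1 s2, 0 <= s1 -> s1 < s2 -> (s2%:E < gen_zero psi)%E ->
        psi s2 < psi s1].

(* For a generator psi and u in ]0, 1], the set {s >= 0 : psi s = u} is a
   singleton, so this is the usual inverse; at u = 0 it is [gen_zero psi]. *)
Definition gen_inv (R : realType) (psi : R -> R) (u : R) : \bar R :=
  ereal_inf [set s%:E | s in [set s : R | 0 <= s /\ psi s = u]].

(* psi extended by psi(+oo) = 0; the value at -oo is never used. *)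
Definition gen_ext (R : realType) (psi : R -> R) (x : \bar R) : R :=
  match x with s%:E => psi s | _ => 0 end.

Definition archimedean (R : realType) (d : nat) (psi : R -> R)
    (u : 'I_d -> R) : R :=
  gen_ext psi (\sum_(j < d) gen_inv psi (u j))%E.

(* The generators of d-dimensional Archimedean copulas. *)
Definition Psi (R : realType) (d : nat) (psi : R -> R) : Prop :=
  generator psi /\ copula (@archimedean R d psi).

Definition logistic (R : realType) (d : nat) (alpha : R)
    (x : 'I_d -> \bar R) : \bar R :=
  ((\sum_(j < d) x j `^ alpha^-1) `^ alpha)%E.

Definition archimax_copula (R : realType) (d : nat) (psi : R -> R)
    (ell : ('I_d -> \bar R) -> \bar R) (C : ('I_d -> R) -> R) : Prop :=
  [/\ Psi d psi, copula C &
      forall u, unit_cube u -> C u = gen_ext psi (ell (fun j => gen_inv psi (u j)))].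

Definition outer_power (R : realType) (alpha : R) (psi : R -> R) : R -> R :=
  fun s => psi (s `^ alpha).

Definition tilted (R : realType) (h : R) (psi : R -> R) : R -> R :=
  fun s => psi (s + h) / psi h.

(* Main.v *)
Require Import Defs.
From HB Require Import structures.
From mathcomp Require Import all_boot all_order all_algebra.
From mathcomp Require Import all_classical all_reals all_analysis.
From mathcomp Require Import measurable_realfun.

Set Implicit Arguments.
Unset Strict Implicit.
Unset Printing Implicit Defensive.

Import Order.TTheory GRing.Theory Num.Theory.
Import numFieldNormedType.Exports.

Local Open Scope classical_set_scope.
Local Open Scope ring_scope.

(** Let g be the generator s |-> psi (s ^ alpha).  Its inverse is the
    inverse of psi raised to the power 1 / alpha, so
    psi (ell_alpha (psi^-1 u_1, .., psi^-1 u_d)) = g (g^-1 u_1 + .. + g^-1 u_d):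
    the logistic Archimax copula is the Archimedean copula of g
    ([archimax_logistic_archimedean]), and what remains is the truncation of
    an Archimedean copula.

    Put a_j = g^-1 t_j, so that h = g^-1 (C t) is the sum of the a_j.  For
    x <= t in the cube, let e_j = g^-1 x_j - a_j >= 0.  Then
      P (U <= x | U <= t) = g (h + sum_j e_j) / g h = psit (sum_j e_j),
    where psit s = g (s + h) / g h.  Taking x_k = t_k for all k <> j gives
    the j-th conditional margin F_j x_j = psit e_j.  Hence e_j is the
    psit-inverse of F_j x_j, and the conditional distribution function is the
    Archimedean copula of psit applied to its margins ([truncation_sklar]).
    The identity e_j = psit^-1 (psit e_j) may fail where psit vanishes, but the
    sums of both sides have the same image under psit ([gen_ext_sum]).

    Uniqueness holds because every F_j takes every value in [0,1]: the value
    v is taken at g (a_j + psit^-1 v).  The same quantile shows that the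
    Archimedean function of psit is a copula: under the conditional law of U
    given U <= t, the vector of the F_j (U_j) has it as its distribution
    function, and its margins are uniform.

    The inverse of a generator is an infimum with values in the extended
    reals; everything about it follows from two facts valid on all of [0,1],
    including 0: it is a right inverse ([gen_invK]) and it is adjoint to the
    generator, g^-1 u <= x iff g x <= u ([gen_inv_le]). *)

(** * Generators and their inverses *)

Section GeneratorTheory.
Variables (R : realType) (psi : R -> R).
Hypothesis gpsi : generator psi.
Implicit Types (s u : R) (x : \bar R).

Lemma gen_ge0 s : 0 <= s -> 0 <= psi s.
Proof. by case: gpsi => _ h _ _ _ /h /andP[]. Qed.

Lemma gen_le1 s : 0 <= s -> psi s <= 1.
Proof. by case: gpsi => _ h _ _ _ /h /andP[]. Qed.

Lemma gen_antimono s1 s2 : 0 <= s1 -> s1 <= s2 -> psi s2 <= psi s1.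
Proof. by case: gpsi => _ _ h _ _; exact: h. Qed.

(** Intermediate value theorem between 0 and an M with psi M < u. *)
Lemma gen_surj u : 0 < u <= 1 -> exists2 s, 0 <= s & psi s = u.
Proof.
case: gpsi => ct _ ni [p0 pcv] _ /andP[u0 u1].
have [M [M0 pM]] : exists M, 0 <= M /\ psi M < u.
  have /cvgrPdist_lt /(_ u u0) [M [_ hM]] := pcv.
  exists (Num.max 0 M + 1); split.
    by rewrite addr_ge0// le_max lexx.
  have := hM (Num.max 0 M + 1); rewrite sub0r normrN => psM.
  apply: le_lt_trans (ler_norm _) (psM _).
  by rewrite ltr_pwDr// le_max lexx orbT.
have cM : {within `[0, M], continuous psi}.
  apply: continuous_subspaceW ct => s /=; rewrite in_itv/= => /andP[] //.
have [|c] := IVT M0 cM (v := u).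
  by rewrite p0 ge_min le_max u1 orbC (ltW pM).
by rewrite in_itv/= => /andP[c0 _] pc; exists c.
Qed.

(** By surjectivity psi takes the value psi s / 2 at some r, which lies to the
    right of s and to the left of every zero; so the infimum of the zeros
    is at least r, hence greater than s. *)
Lemma gen_pos_lt_zero s : 0 <= s -> 0 < psi s -> (s%:E < gen_zero psi)%E.
Proof.
move=> s0 ps.
have [|r r0 pr] := @gen_surj (psi s / 2).
  rewrite divr_gt0//= ler_pdivrMr// (le_trans (gen_le1 s0))//.
  by rewrite mul1r ler1n.
apply: (@lt_le_trans _ _ r%:E).
  rewrite lte_fin ltNge; apply/negP => rs; have := gen_antimono r0 rs.
  by rewrite pr leNgt ltr_pdivrMr// ltr_pMr// ltr1n.
apply: le_ereal_inf_tmp => _ [z [z0 pz] <-]; rewrite lee_fin leNgt.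
apply/negP => /ltW zr; have := gen_antimono z0 zr.
by rewrite pz pr leNgt divr_gt0.
Qed.

(** Strict monotonicity with its domain described by the positivity of psi,
    which is stable under the passage to outer powers and tilts. *)
Lemma gen_strict s1 s2 : 0 <= s1 -> s1 < s2 -> 0 < psi s2 -> psi s2 < psi s1.
Proof.
move=> s10 s12 p2; case: (gpsi) => _ _ _ _; apply => //.
by apply: gen_pos_lt_zero => //; exact: le_trans s10 (ltW s12).
Qed.

Lemma gen_inv_ge0 u : (0 <= gen_inv psi u)%E.
Proof. by apply: le_ereal_inf_tmp => _ [s [s0 _] <-]; rewrite lee_fin. Qed.

Lemma gen_invE s : 0 <= s -> 0 < psi s -> gen_inv psi (psi s) = s%:E.
Proof.
move=> s0 ps; rewrite /gen_inv.
suff -> : [set s' : R | 0 <= s' /\ psi s' = psi s] = [set s].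
  by rewrite image_set1 ereal_inf1.
apply/seteqP; split=> [z /= [z0 zs]|z /= -> //].
apply/eqP; rewrite eq_le !leNgt; apply/andP; split; apply/negP => zls.
  by have := gen_strict s0 zls; rewrite zs ltxx => /(_ ps).
by have := gen_strict z0 zls; rewrite zs ltxx => /(_ ps).
Qed.

Lemma gen_ext_ge0 x : (0 <= x)%E -> 0 <= gen_ext psi x.
Proof. by case: x => //= s; rewrite lee_fin; exact: gen_ge0. Qed.

Lemma gen_ext_le1 x : (0 <= x)%E -> gen_ext psi x <= 1.
Proof. by case: x => //= s; rewrite lee_fin; exact: gen_le1. Qed.

Lemma gen_ext_antimono x y : (0 <= x)%E -> (x <= y)%E ->
  gen_ext psi y <= gen_ext psi x.
Proof.
case: x y => [s| |] [r| |] //=; rewrite ?lee_fin.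
- exact: gen_antimono.
- by move=> s0 _; exact: gen_ge0.
Qed.

(** At u = 0 this says that a finite [gen_zero psi] is a zero of psi, and at
    an infinite one it is the convention psi(+oo) = 0. *)
Lemma gen_invK u : 0 <= u <= 1 -> gen_ext psi (gen_inv psi u) = u.
Proof.
rewrite le_eqVlt => /andP[/orP[/eqP <- _|u0 u1]]; last first.
  have [|s s0 ps] := @gen_surj u; first by rewrite u0.
  by rewrite -ps gen_invE ?ps.
have := gen_inv_ge0 0; case E : (gen_inv psi 0) => [z| |] //=.
rewrite lee_fin => z0; apply/eqP; rewrite eq_le gen_ge0// andbT leNgt.
by apply/negP => /(gen_pos_lt_zero z0); rewrite [gen_zero _]E ltxx.
Qed.

(** The Galois connection between a generator and its inverse. *)
Lemma gen_inv_le u x : 0 <= u <= 1 -> (0 <= x)%E ->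
  (gen_inv psi u <= x)%E = (gen_ext psi x <= u).
Proof.
move=> u01 x0; apply/idP/idP => [ux|].
  by rewrite -[leRHS](gen_invK u01) gen_ext_antimono// gen_inv_ge0.
case: x x0 => [s||]//=; last by move=> _ _; exact: leey.
rewrite lee_fin => s0 psu; move: (u01).
rewrite le_eqVlt => /andP[/orP[/eqP u0 _|u_gt0 u1]].
  apply: ereal_inf_lbound; exists s => //; split => //.
  by apply/eqP; rewrite eq_le psu -u0 gen_ge0.
have [|r r0 pr] := @gen_surj u; first by rewrite u_gt0.
rewrite -pr gen_invE// ?pr// lee_fin leNgt; apply/negP => sr.
by have := gen_strict s0 sr; rewrite pr => /(_ u_gt0); rewrite ltNge psu.
Qed.

(** The inverses of derived generators are computed from this: an adjoint is
    unique, so only the inequality of [gen_inv_le] has to be transported. *)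
Lemma gen_inv_unique u x : 0 <= u <= 1 -> (0 <= x)%E ->
  (forall y, (0 <= y)%E -> (x <= y)%E = (gen_ext psi y <= u)) ->
  gen_inv psi u = x.
Proof.
move=> u01 x0 hx; apply/eqP; rewrite eq_le gen_inv_le// -hx// lexx/=.
by rewrite hx ?gen_inv_ge0// -gen_inv_le// ?gen_inv_ge0.
Qed.

Lemma gen_inv_ext x : (0 <= x)%E -> 0 < gen_ext psi x ->
  gen_inv psi (gen_ext psi x) = x.
Proof. by case: x => [s| |]//=; rewrite ?ltxx//; exact: gen_invE. Qed.

Lemma gen_inv1 : gen_inv psi 1 = 0%E.
Proof.
apply/eqP; rewrite eq_le gen_inv_ge0 andbT gen_inv_le ?ler01 ?lexx//=.
by rewrite gen_le1.
Qed.

(** Where psi y = 0 the inverse returns [gen_zero psi], which may be smaller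
    than y; both sides then vanish. *)
Lemma gen_ext_add x y : (0 <= x)%E -> (0 <= y)%E ->
  gen_ext psi (x + gen_inv psi (gen_ext psi y))%E = gen_ext psi (x + y)%E.
Proof.
move=> x0 y0; have [y_gt0|py0] := ltP 0 (gen_ext psi y).
  by rewrite gen_inv_ext.
have {}py0 : gen_ext psi y = 0 by apply/eqP; rewrite eq_le py0 gen_ext_ge0.
have vanish z : (0 <= z)%E -> gen_ext psi z = 0 -> gen_ext psi (x + z)%E = 0.
  move=> z0 pz; apply/eqP; rewrite eq_le gen_ext_ge0 ?adde_ge0// andbT -pz.
  by rewrite gen_ext_antimono// leeDr.
rewrite py0 !vanish//; first exact: gen_inv_ge0.
by rewrite gen_invK// lexx ler01.
Qed.

Lemma gen_ext_sum (I : Type) (r : seq I) (x : I -> \bar R) :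
  (forall i, 0 <= x i)%E ->
  gen_ext psi (\sum_(i <- r) gen_inv psi (gen_ext psi (x i)))%E
  = gen_ext psi (\sum_(i <- r) x i)%E.
Proof.
move=> x0; suff H y : (0 <= y)%E ->
    gen_ext psi (y + \sum_(i <- r) gen_inv psi (gen_ext psi (x i)))%E
    = gen_ext psi (y + \sum_(i <- r) x i)%E.
  by have := H 0%E (lexx _); rewrite !add0e.
elim: r y => [|i r IHr] y y0; first by rewrite !big_nil.
rewrite !big_cons addeA IHr; last by rewrite adde_ge0// gen_inv_ge0.
by rewrite addeAC gen_ext_add ?adde_ge0 ?sume_ge0// addeAC -addeA.
Qed.

End GeneratorTheory.

(** * Outer powers and tilts *)

Lemma within_continuous_comp_within (U V W : topologicalType) (A : set U)
    (B : set V) (f : U -> V) (g : V -> W) : (forall x, A x -> B (f x)) ->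
  {within A, continuous f} -> {within B, continuous g} ->
  {within A, continuous (g \o f)}.
Proof.
move=> AB /subspace_continuousP cf /subspace_continuousP cg.
apply/subspace_continuousP => x Ax.
have fx : f @ within A (nbhs x) --> within B (nbhs (f x)).
  move=> N; rewrite /within/= => BN; have := cf x Ax _ BN.
  rewrite /= !nbhs_simpl/= /within/= => h.
  by near=> y => Ay; apply: (near h y) => //; exact: AB.
exact: cvg_comp fx (cg _ (AB _ Ax)).
Unshelve. all: by end_near. Qed.

(** Since [powR] is constant equal to 1 on the negative reals when the
    exponent is nonzero, it is only continuous from the right at 0. *)
Lemma within_continuous_powR (R : realType) (a : R) : 0 < a ->
  {within [set s : R | 0 <= s], continuous (@powR R ^~ a)}.
Proof.
move=> a0.
have -> : [set s : R | 0 <= s] = `[0, +oo[%classic.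
  by apply/seteqP; split=> s /=; rewrite in_itv/= andbT.
apply/continuous_within_itvcyP; split=> [x x0|].
  by apply/differentiable_continuous/derivable1_diffP; exact: derivable_powR.
by rewrite powR0 ?gt_eqF//; exact: powR_cvg0.
Qed.

Lemma outer_power_generator (R : realType) (psi : R -> R) (alpha : R) :
  0 < alpha -> generator psi -> generator (outer_power alpha psi).
Proof.
move=> a0 gpsi; case: (gpsi) => ct b01 ni [p0 pcv] _.
have ne0 : alpha != 0 by rewrite gt_eqF.
split.
- apply: (within_continuous_comp_within _ (within_continuous_powR a0) ct) => s _ /=.
  exact: powR_ge0.
- by move=> s _; apply: b01; exact: powR_ge0.
- move=> s1 s2 s10 s12; apply: ni; first exact: powR_ge0.
  by apply: ge0_ler_powR => //; rewrite ?nnegrE ?(le_trans s10 s12)// ltW.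
- split; first by rewrite /outer_power powR0.
  apply/cvgrPdist_lt => e e0; have /cvgrPdist_lt /(_ e e0) [M [_ hM]] := pcv.
  (* s > max(0, M) ^ (1 / alpha) implies s ^ alpha > M *)
  exists (Num.max 0 M `^ alpha^-1); split; first exact: num_real.
  move=> s Ms; apply: hM; have M0 : 0 <= Num.max 0 M by rewrite le_max lexx.
  apply: (@le_lt_trans _ _ (Num.max 0 M)); first by rewrite le_max lexx orbT.
  rewrite -(powRr1 M0) -(mulVf ne0) powRrM; apply: gt0_ltr_powR => //.
    by rewrite nnegrE powR_ge0.
  by rewrite nnegrE (le_trans _ (ltW Ms))// powR_ge0.
- move=> s1 s2 s10 s12 hs; have s20 := le_trans s10 (ltW s12).
  apply: (gen_strict gpsi); rewrite ?powR_ge0//; first exact: gt0_ltr_powR.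
  rewrite lt_def gen_ge0 ?powR_ge0// andbT; apply/eqP => ps0.
  have : (gen_zero (outer_power alpha psi) <= s2%:E)%E.
    by apply: ereal_inf_lbound; exists s2.
  by rewrite leNgt hs.
Qed.

Lemma tilted_generator (R : realType) (psi : R -> R) (h : R) :
  0 <= h -> 0 < psi h -> generator psi -> generator (tilted h psi).
Proof.
move=> h0 ph gpsi; case: (gpsi) => ct b01 ni [p0 pcv] _.
split.
- have ch : {within [set s : R | 0 <= s], continuous (fun s : R => s + h)}.
    by apply: continuous_subspaceT => s; apply: cvgD; [exact: cvg_id|exact: cvg_cst].
  have hA s : [set s : R | 0 <= s] s -> [set s : R | 0 <= s] (s + h).
    by move=> /= s0; exact: addr_ge0.
  have := within_continuous_comp_within hA ch ct.
  move=> cph s; apply: cvgM; first exact: cph.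
  exact: cvg_cst.
- move=> s s0; rewrite /tilted divr_ge0 ?(gen_ge0 gpsi) ?addr_ge0//=.
  by rewrite ler_pdivrMr// mul1r ni// lerDr.
- move=> s1 s2 s10 s12; rewrite /tilted ler_pM2r ?invr_gt0//.
  by apply: ni; rewrite ?addr_ge0 ?lerD2r.
- split; first by rewrite /tilted add0r divff// gt_eqF.
  rewrite -(mul0r (psi h)^-1); apply: cvgM; last exact: cvg_cst.
  apply: (@cvg_comp _ _ _ (fun s => s + h) psi _ (pinfty_nbhs R)) => //.
  exact: cvg_addrr.
- move=> s1 s2 s10 s12 hs; have s20 := le_trans s10 (ltW s12).
  rewrite /tilted ltr_pM2r ?invr_gt0//.
  apply: (gen_strict gpsi) => //; rewrite ?addr_ge0 ?ltrD2r//.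
  rewrite lt_def gen_ge0 ?addr_ge0// andbT; apply/eqP => ps0.
  have : (gen_zero (tilted h psi) <= s2%:E)%E.
    by apply: ereal_inf_lbound; exists s2 => //; split => //; rewrite /tilted ps0 mul0r.
  by rewrite leNgt hs.
Qed.

Lemma gen_ext_outer_power (R : realType) (psi : R -> R) (alpha : R) (x : \bar R) :
  0 < alpha -> (0 <= x)%E ->
  gen_ext (outer_power alpha psi) x = gen_ext psi (x `^ alpha)%E.
Proof. by case: x => //= a0 _; rewrite gt_eqF. Qed.

(** On the extended half-line, x |-> x ^ (1 / alpha) is adjoint to
    y |-> y ^ alpha, being its inverse. *)
Lemma poweR_le_inv (R : realType) (alpha : R) (x y : \bar R) : 0 < alpha ->
  (0 <= x)%E -> (0 <= y)%E -> (x `^ alpha^-1 <= y)%E = (x <= y `^ alpha)%E.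
Proof.
move=> a0 x0 y0; have ne0 : alpha != 0 by rewrite gt_eqF.
have in0 (z : \bar R) : (0 <= z)%E -> z \in `[0%E, +oo%E].
  by move=> z0; rewrite in_itv/= z0 leey.
apply/idP/idP => h.
  rewrite -(poweRe1 x0) -(mulVf ne0) poweRrM.
  by apply: (gt0_ler_poweR (ltW a0)) h; rewrite in0// poweR_ge0.
rewrite -(poweRe1 y0) -(mulfV ne0) poweRrM.
by apply: gt0_ler_poweR h; rewrite ?in0 ?poweR_ge0 ?invr_ge0 ?(ltW a0).
Qed.

Lemma gen_inv_outer_power (R : realType) (psi : R -> R) (alpha u : R) :
  0 < alpha -> generator psi -> 0 <= u <= 1 ->
  gen_inv (outer_power alpha psi) u = (gen_inv psi u `^ alpha^-1)%E.
Proof.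
move=> a0 gpsi u01; apply: gen_inv_unique => //.
- exact: outer_power_generator.
- exact: poweR_ge0.
move=> y y0; rewrite poweR_le_inv ?gen_inv_ge0// gen_ext_outer_power//.
by rewrite gen_inv_le// poweR_ge0.
Qed.

Lemma gen_ext_tilted (R : realType) (psi : R -> R) (h : R) (x : \bar R) :
  (0 <= x)%E -> gen_ext (tilted h psi) x = gen_ext psi (x + h%:E)%E / psi h.
Proof. by case: x => //= _; rewrite mul0r. Qed.

(** * Right truncation of an Archimedean copula *)

Lemma measurable_sublevel (R : realType) (disp : measure_display)
    (T : measurableType disp) (X : {mfun T >-> R}) (r : R) :
  measurable [set w | X w <= r].
Proof.
have -> : [set w | X w <= r] = X @^-1` `]-oo, r].
  by apply/seteqP; split=> w /=; rewrite in_itv.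
exact: measurable_funPTI.
Qed.

Lemma measurable_orthant (R : realType) (d : nat) (disp : measure_display)
    (T : measurableType disp) (X : 'I_d -> {mfun T >-> R}) (x : 'I_d -> R) :
  measurable [set w | forall j, X j w <= x j].
Proof.
have -> : [set w | forall j, X j w <= x j]
    = \bigcap_(j in [set: 'I_d]) [set w | X j w <= x j].
  by apply/seteqP; split=> w wx j; [move=> _; exact: wx|exact: wx].
by apply: fin_bigcap_measurable => // j _; exact: measurable_sublevel.
Qed.

(** The generator g of the outline above is called psi in this section. *)
Section TruncatedArchimedean.
Variables (R : realType) (d : nat) (psi : R -> R) (C : ('I_d -> R) -> R).
Variable t : 'I_d -> R.
Hypothesis gpsi : generator psi.
Hypothesis CE : forall u, unit_cube u -> C u = archimedean psi u.
Hypothesis t01 : forall j, 0 < t j <= 1.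
Hypothesis Ct_gt0 : 0 < C t.

Let a j := gen_inv psi (t j).
Let h := fine (gen_inv psi (C t)).
Let psit := tilted h psi.

Let cube_t : unit_cube t.
Proof. by move=> j; case/andP: (t01 j) => /ltW -> ->. Qed.

Let a_ge0 j : (0 <= a j)%E.
Proof. exact: gen_inv_ge0. Qed.

Let sum_a : gen_inv psi (C t) = (\sum_j a j)%E.
Proof.
move: Ct_gt0; rewrite CE// /archimedean => p0.
by rewrite gen_inv_ext// sume_ge0// => j _; exact: a_ge0.
Qed.

Lemma truncation_tilt_fin_num : gen_inv psi (C t) \is a fin_num.
Proof.
rewrite sum_a; move: Ct_gt0; rewrite CE// /archimedean -/(a _).
by have := @sume_ge0 _ _ a xpredT (fun j _ => a_ge0 j) (index_enum _);
  case: (\sum_j _)%E => //=; rewrite ltxx.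
Qed.

Let hE : (\sum_j a j)%E = h%:E.
Proof. by rewrite -sum_a fineK// truncation_tilt_fin_num. Qed.

Lemma truncation_tilt_ge0 : 0 <= h.
Proof. by rewrite -lee_fin -hE sume_ge0. Qed.

Let psi_h : psi h = C t.
Proof. by rewrite CE// /archimedean hE. Qed.

Lemma truncation_generator : generator psit.
Proof. by apply: tilted_generator; rewrite ?truncation_tilt_ge0 ?psi_h. Qed.

Let gpsit := truncation_generator.

Let a_le_h j : (a j <= h%:E)%E.
Proof. by rewrite -hE (bigD1 j)//= leeDl// sume_ge0. Qed.

Let a_fin j : a j \is a fin_num.
Proof. by rewrite ge0_fin_numE// (le_lt_trans (a_le_h j))// ltry. Qed.

(** For a point x of R^d, the events U <= x and U <= t together amount almost
    surely to U <= clamp x, and clamp x is in the cube. *)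
Let clamp (x : 'I_d -> R) (j : 'I_d) : R := Num.max 0 (Num.min (x j) (t j)).

Let clamp_ge0 x j : 0 <= clamp x j.
Proof. by rewrite /clamp le_max lexx. Qed.

Let clamp_le x j : clamp x j <= t j.
Proof.
by rewrite /clamp ge_max ge_min lexx orbT andbT; case/andP: (t01 j) => /ltW.
Qed.

Let cube_clamp x : unit_cube (clamp x).
Proof.
move=> j; rewrite clamp_ge0/= (le_trans (clamp_le x j))//.
by case/andP: (t01 j).
Qed.

(** The extended real e_j of the outline for the point clamp x; it is +oo when clamp x j = 0 and psi
    has no zero. *)
Let excess x j := (gen_inv psi (clamp x j) - a j)%E.

Let excessK x j : (excess x j + a j)%E = gen_inv psi (clamp x j).
Proof. by rewrite /excess subeK. Qed.

Let excess_ge0 x j : (0 <= excess x j)%E.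
Proof.
rewrite /excess sube_ge0 ?a_fin// /a gen_inv_le ?gen_inv_ge0//.
by rewrite gen_invK//; exact: cube_clamp.
Qed.

Let C_clamp x : C (clamp x) / C t = gen_ext psit (\sum_j excess x j)%E.
Proof.
rewrite gen_ext_tilted; last exact: sume_ge0.
rewrite psi_h CE// /archimedean -hE -big_split/=.
by congr (gen_ext _ _ / _); apply: eq_bigr => j _; rewrite excessK.
Qed.

Section RandomVector.
Variables (disp : measure_display) (T : measurableType disp).
Variables (P : probability T R) (U : 'I_d -> {RV P >-> R}).
Hypothesis dfU : has_copula_df U C.

Let below (x : 'I_d -> R) := [set w | forall j, U j w <= x j].
Let B := below t.

Let measurable_below x : measurable (below x).
Proof. exact: measurable_orthant. Qed.

Let mB : measurable B := measurable_below t.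

Let mIB A : measurable A -> measurable (A `&` B).
Proof. by move=> mA; exact: measurableI mA mB. Qed.

Let PB : P B = (C t)%:E.
Proof. exact: dfU. Qed.

Let P_fin A : measurable A -> P A \is a fin_num.
Proof. exact: fin_num_measure. Qed.

Let cond_probE A : cond_prob P B A = fine (P (A `&` B)) / C t.
Proof. by rewrite /cond_prob PB. Qed.

Let cond_prob_le A A' : measurable A -> measurable A' -> A `<=` A' ->
  cond_prob P B A <= cond_prob P B A'.
Proof.
move=> mA mA' AA'; rewrite !cond_probE ler_pM2r ?invr_gt0//.
apply: fine_le; [exact/P_fin/mIB|exact/P_fin/mIB|].
apply: le_measure; rewrite ?inE; [exact: mIB|exact: mIB|exact: setSI].
Qed.

(** If some x_j is negative, the event is contained in the event U <= clamp x
    whose j-th bound is 0, and C vanishes there; so both sides are 0. *)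
Let cond_prob_below x : cond_prob P B (below x) = gen_ext psit (\sum_j excess x j)%E.
Proof.
rewrite -C_clamp cond_probE; congr (_ / _).
have mI := mIB (measurable_below x).
have sub : below x `&` B `<=` below (clamp x).
  by move=> w [wx wt] j; rewrite /clamp le_max le_min wx wt orbT.
have PC : P (below (clamp x)) = (C (clamp x))%:E by apply: dfU.
have [x0|] := pselect (forall j, 0 <= x j).
  suff -> : below x `&` B = below (clamp x) by rewrite PC.
  apply/seteqP; split=> // w wc; split=> j; have := wc j; rewrite /clamp.
    rewrite le_max le_min => /orP[/le_trans|/andP[]//]; exact.
  by move/le_trans; apply; exact: clamp_le.
move=> /existsNP[j /negP]; rewrite -ltNge => xj.
have C0 : C (clamp x) = 0.
  apply/eqP; rewrite CE// eq_le gen_ext_ge0 ?sume_ge0 ?andbT//; last first.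
    by move=> i _; exact: gen_inv_ge0.
  rewrite -(gen_invK gpsi (u := 0)) ?lexx ?ler01//.
  apply: gen_ext_antimono => //; first exact: gen_inv_ge0.
  rewrite (bigD1 j)//= /clamp max_l; last by rewrite ge_min (ltW xj).
  by rewrite leeDl// sume_ge0// => i _; exact: gen_inv_ge0.
apply/eqP; rewrite C0 eq_le fine_ge0// andbT -lee_fin fineK ?P_fin//.
by rewrite -C0 -PC le_measure ?inE.
Qed.

Let margin j (x : R) := cond_prob P B [set w | U j w <= x].

(** Truncating at x_j in one coordinate only, the other bounds being those
    of t, turns a conditional margin into a conditional joint probability. *)
Let only j (x : R) k := if k == j then x else t k.

Let marginE x j : margin j (x j) = gen_ext psit (excess x j).
Proof.
have -> : margin j (x j) = cond_prob P B (below (only j (x j))).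
  rewrite /margin !cond_probE; congr (fine (P _) / _); apply/seteqP; split.
    move=> w [wx wt]; split=> // k; rewrite /only; case: eqP => [->//|_].
    exact: wt.
  by move=> w [wx wt]; split=> //; have := wx j; rewrite /only eqxx.
rewrite cond_prob_below (bigD1 j)//= big1 ?adde0.
  by rewrite /excess /clamp /only eqxx.
move=> k kj; rewrite /excess /clamp /only (negbTE kj) minxx max_r.
  exact: subee (a_fin k).
by case/andP: (cube_t k).
Qed.

(** Sklar's identity: psit of the sum of the e_j is unchanged if each e_j is
    replaced by the psit-inverse of the margin psit e_j. *)
Lemma truncation_sklar x :
  cond_prob P B (below x) = archimedean psit (fun j => margin j (x j)).
Proof.
rewrite cond_prob_below -(gen_ext_sum gpsit)//.
by congr gen_ext; apply: eq_bigr => j _; rewrite marginE.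
Qed.

(** The j-th conditional quantile of u_j, obtained by solving F_j x = u_j,
    that is psit (psi^-1 x - a_j) = u_j. *)
Let quantile (u : 'I_d -> R) j := gen_ext psi (a j + gen_inv psit (u j))%E.

Let quantile_le u j : quantile u j <= t j.
Proof.
rewrite -[leRHS](gen_invK gpsi (u := t j)); last exact: cube_t.
apply: gen_ext_antimono => //; first exact: gen_inv_ge0.
by rewrite leeDl// gen_inv_ge0.
Qed.

Let quantile_ge0 u j : 0 <= quantile u j.
Proof. by rewrite gen_ext_ge0// adde_ge0// gen_inv_ge0. Qed.

(** The excess of the quantile is the psit-inverse of u_j, except possibly
    where psi vanishes; [gen_ext_add] absorbs the difference because
    h - a_j >= 0. *)
Let margin_quantile u j : 0 <= u j <= 1 -> margin j (quantile u j) = u j.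
Proof.
move=> u01; have g0 := gen_inv_ge0 psit (u j).
rewrite marginE gen_ext_tilted//.
have -> : (excess (quantile u) j + h%:E =
    (h%:E - a j) + gen_inv psi (quantile u j))%E.
  rewrite /excess /clamp min_l ?quantile_le// max_r ?quantile_ge0//.
  by rewrite addeAC [in LHS](addeC _ h%:E) addeAC.
rewrite gen_ext_add//; last 2 first.
- by rewrite sube_ge0 ?a_fin.
- by rewrite adde_ge0.
by rewrite addeA subeK// addeC -gen_ext_tilted// gen_invK.
Qed.

Let margin_le j : {homo margin j : x y / x <= y}.
Proof.
move=> x y xy; apply: cond_prob_le; try exact: measurable_sublevel.
by move=> w /= wx; exact: le_trans wx xy.
Qed.

(** On x <= t_j, the quantile is the largest solution of F_j x <= u_j, so the
    events F_j (U_j) <= u_j and U_j <= quantile coincide given U <= t. *)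
Let margin_le_quantile u j (x : R) : 0 <= u j <= 1 -> x <= t j ->
  (margin j x <= u j) = (x <= quantile u j).
Proof.
move=> u01 xt; apply/idP/idP; last first.
  by move=> /(margin_le j); rewrite margin_quantile.
rewrite (marginE (fun=> x)) -gen_inv_le// /excess leeBrDl// => le_inv.
have [x0|x0] := ltP x 0; first exact: le_trans (ltW x0) (quantile_ge0 u j).
have cx : clamp (fun=> x) j = x by rewrite /clamp min_l// max_r.
have x01 : 0 <= x <= 1 by rewrite -cx; exact: cube_clamp.
rewrite -[leLHS](gen_invK gpsi x01) gen_ext_antimono ?adde_ge0 ?gen_inv_ge0//.
by rewrite -cx.
Qed.

Let margin01 j x : 0 <= margin j x <= 1.
Proof.
rewrite (marginE (fun=> x)); apply/andP; split.
  exact: gen_ext_ge0.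
exact: gen_ext_le1.
Qed.

(** The margins are onto [0,1], so Sklar's identity determines D on the whole
    cube. *)
Lemma truncation_unique D : right_truncated_copula U t D ->
  forall u, unit_cube u -> D u = archimedean psit u.
Proof.
move=> [_ DE] u u01.
have qE : (fun j => margin j (quantile u j)) = u.
  by apply/funext => j; exact: margin_quantile.
have : archimedean psit (fun j => margin j (quantile u j))
    = D (fun j => margin j (quantile u j)).
  by rewrite -truncation_sklar; exact: DE.
by rewrite qE => ->.
Qed.

Let measurable_margin j : measurable_fun setT (margin j \o U j).
Proof. by apply: measurableT_comp => //; exact: nondecreasing_measurable. Qed.

(** The conditional law P ( . | B); [mnormalize] returns its second
    argument when B is null, which P B = C t > 0 excludes. *)
Let Q : probability T R := mnormalize (mrestr P mB) P.

Let QE A : measurable A -> Q A = (cond_prob P B A)%:E.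
Proof.
move=> mA; rewrite cond_probE /Q /= /mnormalize /=.
have -> : mrestr P mB setT = (C t)%:E by rewrite /mrestr setTI.
by rewrite eqe gt_eqF//= EFinM /mrestr fineK// P_fin//; exact: mIB.
Qed.

(** The conditional probability integral transform of U. *)
Let V j : {RV Q >-> R} := mfun_Sub (mem_set (measurable_margin j)).

Let dfV : has_copula_df V (archimedean psit).
Proof.
move=> u u01; rewrite QE; last exact: measurable_orthant.
suff -> : cond_prob P B [set w | forall j, V j w <= u j]
    = cond_prob P B (below (quantile u)).
  rewrite truncation_sklar; congr (archimedean _ _)%:E.
  by apply/funext => j; exact: margin_quantile.
rewrite !cond_probE; congr (fine (P _) / _).
apply/seteqP; split=> w [wu wt]; split=> // j; have := wu j;
  by rewrite /= margin_le_quantile.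
Qed.

(** The margins come from [dfV] by putting all other arguments equal to 1,
    where the inverse of psit is 0. *)
Lemma truncation_copula : copula (archimedean psit : ('I_d -> R) -> R).
Proof.
exists disp, T, Q, V; split; last exact: dfV.
move=> j r r01; pose u k := if k == j then r else 1.
have u01 : unit_cube u.
  by move=> k; rewrite /u; case: ifP => _//; rewrite ler01 lexx.
have -> : cdf (V j) r = Q [set w | forall k, V k w <= u k].
  rewrite /cdf /distribution /pushforward; congr (Q _); apply/seteqP; split=> w /=.
    rewrite in_itv/= => wr k; rewrite /u; case: eqP => [->//|_].
    by case/andP: (margin01 k (U k w)).
  by move=> /(_ j); rewrite /u eqxx in_itv.
rewrite dfV// /archimedean (bigD1 j)//= big1 ?adde0.
  by rewrite /u eqxx gen_invK.
by move=> k /negbTE kj; rewrite /u kj gen_inv1.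
Qed.

Lemma truncation_right_truncated_copula :
  right_truncated_copula U t (archimedean psit).
Proof. by split; [exact: truncation_copula|exact: truncation_sklar]. Qed.

End RandomVector.
End TruncatedArchimedean.

(** * Logistic Archimax copulas *)

Lemma eq_copula (R : realType) (d : nat) (C D : ('I_d -> R) -> R) :
  (forall u, unit_cube u -> C u = D u) -> copula C -> copula D.
Proof.
move=> CD [disp [T [P [U [margins dfU]]]]].
exists disp, T, P, U; split=> // u u01.
by rewrite -CD//; exact: dfU.
Qed.

Lemma archimax_logistic_archimedean (R : realType) (d : nat) (psi : R -> R)
    (alpha : R) (u : 'I_d -> R) : 0 < alpha -> generator psi -> unit_cube u ->
  gen_ext psi (logistic alpha (fun j => gen_inv psi (u j)))
  = archimedean (outer_power alpha psi) u.
Proof.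
move=> a0 gpsi u01; rewrite /archimedean /logistic.
rewrite gen_ext_outer_power//; last by apply: sume_ge0 => j _; exact: gen_inv_ge0.
congr (gen_ext _ (_ `^ _)%E); apply: eq_bigr => j _.
by rewrite gen_inv_outer_power.
Qed.

Theorem mainTheorem4 (R : realType) (d : nat) (psi : R -> R) (alpha : R)
    (C : ('I_d -> R) -> R) (t : 'I_d -> R)
    (halpha : 0 < alpha <= 1)
    (hC : archimax_copula psi (logistic alpha) C)
    (ht : forall j, 0 < t j <= 1)
    (hCt : 0 < C t) :
  let psio := outer_power alpha psi in
  let h := fine (gen_inv psio (C t)) in
  let psit := tilted h psio in
  [/\ gen_inv psio (C t) \is a fin_num,
      0 <= h,
      Psi d psio,
      Psi d psit &
      forall (disp : measure_display) (T : measurableType disp)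
             (P : probability T R) (U : 'I_d -> {RV P >-> R}),
        has_copula_df U C ->
        right_truncated_copula U t (archimedean psit) /\
        (forall D, right_truncated_copula U t D ->
           forall u, unit_cube u -> D u = archimedean psit u)].
Proof.
move=> psio h psit; have a_gt0 : 0 < alpha by case/andP: halpha.
have [[gpsi _] cC CE] := hC.
have gpsio : generator psio by exact: outer_power_generator.
have CEo u : unit_cube u -> C u = archimedean psio u.
  by move=> u01; rewrite CE// archimax_logistic_archimedean.
split.
- exact: truncation_tilt_fin_num CEo ht hCt.
- exact: truncation_tilt_ge0 CEo ht hCt.
- by split=> //; exact: eq_copula CEo cC.
- split; first exact: truncation_generator CEo ht hCt.
  have [disp [T [P [U [_ dfU]]]]] := cC.
  exact: truncation_copula CEo ht hCt _ _ _ _ dfU.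
- move=> disp T P U dfU; split.
    exact: truncation_right_truncated_copula CEo ht hCt _ _ _ _ dfU.
  exact: truncation_unique CEo ht hCt _ _ _ _ dfU.
Qed.
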